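(* If $G$ is a well-covered graph with no isolatable vertices, then $G \Box K_2$ is well-covered.
   Context: All graphs are finite and simple. A graph is well-covered if all its maximal independent sets have the same cardinality. A vertex $w$ of a graph $X$ is isolatable in $X$ if there exists an independent set $J$ of $X$ such that $V(X)-N[J]=\{w\}$, where $N[J]$ is $J$ together with all vertices adjacent to some vertex of $J$. The Cartesian product $G \Box K_2$ has vertex set $V(G)\times\{1,2\}$, with $(g_1,i)$ adjacent to $(g_2,j)$ if either $g_1=g_2$ and $i\neq j$, or $i=j$ and $g_1g_2\in E(G)$. *)

(* Defs.v *)
From mathcomp Require Import all_boot.
Set Implicit Arguments.
Unset Strict Implicit.
Unset Printing Implicit Defensive.

Record sgraph := SGraph {
  vertex :> finType;
  edge : rel vertex;
  edge_sym : symmetric edge;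
  edge_irrefl : irreflexive edge
}.

Definition independent (G : sgraph) (A : {set G}) : bool :=
  [forall x in A, forall y in A, ~~ edge x y].

Definition well_covered (G : sgraph) : Prop :=
  forall A B : {set G},
    maxset (@independent G) A -> maxset (@independent G) B -> #|A| = #|B|.

Definition closed_nbhd (G : sgraph) (J : {set G}) : {set G} :=
  J :|: [set v | [exists u in J, edge u v]].

Definition isolatable (G : sgraph) (w : G) : Prop :=
  exists J : {set G}, independent J /\ [set: G] :\: closed_nbhd J = [set w].

(* Cartesian product of G with K_2; the two vertices of K_2 are the booleans. *)
Section BoxK2.
Variable G : sgraph.

Definition box_K2_edge (p q : G * bool) : bool :=
  ((p.1 == q.1) && (p.2 != q.2)) || ((p.2 == q.2) && edge p.1 q.1).

Lemma box_K2_edge_sym : symmetric box_K2_edge.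
Proof.
by move=> p q; rewrite /box_K2_edge edge_sym ![q.1 == _]eq_sym ![q.2 == _]eq_sym.
Qed.

Lemma box_K2_edge_irrefl : irreflexive box_K2_edge.
Proof. by move=> p; rewrite /box_K2_edge !eqxx edge_irrefl. Qed.

Definition box_K2 : sgraph := SGraph box_K2_edge_sym box_K2_edge_irrefl.

End BoxK2.

(* Main.v *)
(** A maximal independent set of [G □ K_2] consists of two independent sets
    [A_0], [A_1] of [G], one in each layer.  A vertex of layer [i] not dominated
    by [A_i] inside its layer must have its twin in [A_(1-i)], so
    [S = V(G) - N[A_i]] is independent.  If [S] contained some [w], then
    [A_i ∪ (S - w)] would isolate [w].  Hence [A_0] and [A_1] are both maximal
    independent sets of [G], and their sizes add up to twice the independence
    number of [G]. *)
Require Import Defs.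
From mathcomp Require Import all_boot.

Lemma independentP (G : sgraph) (A : {set G}) :
  reflect {in A &, forall x y, ~~ edge x y} (independent A).
Proof.
apply: (iffP forall_inP) => [indA x y xA yA | indA x xA].
  exact: (forall_inP (indA x xA)).
by apply/forall_inP => y; apply: indA.
Qed.

Lemma closed_nbhdP (G : sgraph) (J : {set G}) (v : G) :
  reflect (v \in J \/ exists2 u, u \in J & edge u v) (v \in closed_nbhd J).
Proof.
rewrite /closed_nbhd !inE.
by apply: (iffP orP) => -[vJ | /exists_inP uJ]; [left | right | left | right].
Qed.

(** An undominated vertex could be added to [A], while a dominated vertex outside [A] lies in no
    independent superset. This trades maximality for domination, which can be examined layer by
    layer. *)
Lemma maxset_independentE (G : sgraph) (A : {set G}) :
  maxset (@independent G) A = independent A && (closed_nbhd A == setT).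
Proof.
apply/maxsetP/andP => [[indA maxA] | [indA /eqP domA]]; split=> //.
  apply/eqP/setP => v; rewrite in_setT; apply/closed_nbhdP.
  case: (boolP [exists u in A, edge u v]) => [/exists_inP | noedge]; first by right.
  have Av u : u \in A -> edge u v = false.
    by move=> uA; apply: contraNF noedge => uv; apply/exists_inP; exists u.
  left; rewrite -[A](maxA (v |: A)) ?setU11 ?subsetUr //.
  apply/independentP => x y /setU1P[-> | xA] /setU1P[-> | yA].
  - by rewrite edge_irrefl.
  - by rewrite edge_sym Av.
  - by rewrite Av.
  - exact: (independentP _ _ indA).
move=> B /independentP indB sAB; apply/eqP; rewrite eqEsubset sAB andbT.
apply/subsetP => v vB.
have: v \in closed_nbhd A by rewrite domA in_setT.
case/closed_nbhdP => // -[u /(subsetP sAB) uB uv].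
by have := indB _ _ uB vB; rewrite uv.
Qed.

(** No edge joins [A] to the undominated set, so all of that set except [w] can be added to [A]
    without breaking independence or dominating [w]. *)
Lemma isolatable_of_independent_rest (G : sgraph) (A : {set G}) (w : G) :
  independent A -> independent (~: closed_nbhd A) -> w \notin closed_nbhd A ->
  isolatable w.
Proof.
move=> /independentP indA /independentP; set S := ~: _ => indS wA.
have wS : w \in S by rewrite in_setC.
have AS x y : x \in A -> y \in S -> ~~ edge x y.
  rewrite in_setC => xA; apply: contra => xy.
  by apply/closed_nbhdP; right; exists x.
exists (A :|: S :\ w); split.
  apply/independentP => x y /setUP[xA | /setD1P[_ xS]] /setUP[yA | /setD1P[_ yS]].
  - exact: indA.
  - exact: AS.
  - by rewrite edge_sym AS.
  - exact: indS.
apply/setP => v; rewrite in_setD in_set1 in_setT andbT.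
have [-> | vw] := eqVneq v w.
  apply/closed_nbhdP => -[/setUP[wA' | /setD1P[]] | [u /setUP[uA | /setD1P[_ uS]]]].
  - by case/closed_nbhdP: wA; left.
  - by rewrite eqxx.
  - by rewrite (negPf (AS _ _ uA wS)).
  - by rewrite (negPf (indS _ _ uS wS)).
apply/negbTE; rewrite negbK; apply/closed_nbhdP.
(* A vertex of [S] other than [w] is in the witness itself; any vertex outside [S] is already
   dominated by [A]. *)
case: (boolP (v \in S)) => [vS | ]; first by left; rewrite !(vw, vS, in_setU, in_setD1) orbT.
rewrite in_setC negbK => /closed_nbhdP[vA | [u uA uv]]; first by left; rewrite in_setU vA.
by right; exists u; rewrite // in_setU uA.
Qed.

Definition layer {G : sgraph} (X : {set box_K2 G}) (i : bool) : {set G} :=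
  [set g | (g, i) \in X].

Lemma card_layers (G : sgraph) (X : {set box_K2 G}) :
  #|X| = #|layer X true| + #|layer X false|.
Proof.
(* Membership is written through both projections so that [pair_big_dep], read backwards, gives a
   double sum over vertices and layers. *)
rewrite -!sum1_card (eq_bigl (fun p => (p.1, p.2) \in X)); last by case.
rewrite -(pair_big_dep predT (fun g i => (g, i) \in X) (fun _ _ => 1)) /=.
rewrite [in RHS]big_mkcond [X in _ + X]big_mkcond -big_split.
by apply: eq_bigr => g _; rewrite big_mkcond big_bool !inE.
Qed.

Lemma independent_layer (G : sgraph) (X : {set box_K2 G}) (i : bool) :
  independent X -> independent (layer X i).
Proof.
move=> /independentP indX; apply/independentP => x y; rewrite !inE => xX yX.
by have := indX _ _ xX yX; rewrite /= /box_K2_edge /= !eqxx andbF.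
Qed.

(** The only neighbour of [(v, i)] outside layer [i] is its twin [(v, ~~ i)], so only the twin is
    left to dominate it. *)
Lemma undominated_in_other_layer (G : sgraph) (X : {set box_K2 G}) (i : bool) :
  closed_nbhd X = setT -> ~: closed_nbhd (layer X i) \subset layer X (~~ i).
Proof.
move=> domX; apply/subsetP => v; rewrite !in_setC => /closed_nbhdP vN.
have: (v, i) \in closed_nbhd X by rewrite domX in_setT.
case/closed_nbhdP => [viX | [[u j] ujX]]; first by case: vN; left; rewrite inE.
rewrite /= /box_K2_edge /= => /orP[/andP[/eqP uv ji] | /andP[/eqP ji uv]].
  by rewrite inE -uv; case: i j ji ujX {vN} => [] [].
by case: vN; right; exists u; rewrite // inE -ji.
Qed.

Lemma maxset_layer (G : sgraph) (X : {set box_K2 G}) (i : bool) :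
  (forall w : G, ~ isolatable w) -> maxset (@independent (box_K2 G)) X ->
  maxset (@independent G) (layer X i).
Proof.
move=> Gni; rewrite !maxset_independentE => /andP[indX /eqP domX].
rewrite independent_layer //= -subTset; apply/subsetP => w _.
apply/negPn/negP => wN; apply: (Gni w).
apply: isolatable_of_independent_rest wN; first exact: independent_layer.
(* The vertices undominated in layer [i] inherit independence from the other layer. *)
have /subsetP sub := undominated_in_other_layer _ _ i domX.
apply/independentP => x y /sub xX /sub yX.
by have /independentP := independent_layer _ _ (~~ i) indX; apply.
Qed.

Theorem theorem3p9 (G : sgraph) (Gwc : well_covered G)
  (Gni : forall w : G, ~ isolatable w) : well_covered (box_K2 G).
Proof.
move=> X Y maxX maxY; rewrite !card_layers.
(* Each layer of [X] is compared with the same layer of [Y]. *)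
by congr (_ + _); apply: Gwc; apply: maxset_layer.
Qed.
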